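(* For all $\beta_1,\beta_2\in(0,1)$ with $\beta_1+\beta_2\ge 1$ and $\beta_1\beta_2<1/4$ we have $$\sup\{\dim_H\mu \;:\; \mu \text{ is an } f_{\beta_1,\beta_2}\text{-ergodic Borel probability measure on }[-1,1]^2\}<2.$$
   Context: For $\beta_1,\beta_2\in(0,1)$ the generalized Baker's transformation $f_{\beta_1,\beta_2}:[-1,1]^2\to[-1,1]^2$ is defined by $$f_{\beta_1,\beta_2}(x,y)=\begin{cases}(\beta_1x+(1-\beta_1),\,2y-1)&\text{if }y\ge 0,\\(\beta_2x-(1-\beta_2),\,2y+1)&\text{if }y<0.\end{cases}$$ An $f$-ergodic measure is an $f$-invariant ergodic Borel probability measure. The Hausdorff dimension of a Borel probability measure $\mu$ is $\dim_H\mu=\inf\{\dim_H B: B \text{ Borel},\ \mu(B)=1\}$. *)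

(* Defs.v *)
From HB Require Import structures.
From mathcomp Require Import all_boot all_order all_algebra.
From mathcomp Require Import all_classical all_reals all_analysis.

Set Implicit Arguments.
Unset Strict Implicit.
Unset Printing Implicit Defensive.

Import Order.TTheory GRing.Theory Num.Theory.
Import numFieldNormedType.Exports.

Local Open Scope classical_set_scope.
Local Open Scope ring_scope.

(* The product sigma-algebra of this type is the Borel sigma-algebra of the
   plane. *)
Notation plane R := (measurableTypeR R * measurableTypeR R)%type.

Section hausdorff.
Context {R : realType}.

(* The norm that the library puts on a product is the maximum norm. *)
Definition eucl_dist (p q : plane R) : R :=
  Num.sqrt ((p.1 - q.1) ^+ 2 + (p.2 - q.2) ^+ 2).

(* diam set0 = -oo *)
Definition diam (U : set (plane R)) : \bar R :=
  ereal_sup [set (eucl_dist p q)%:E | p in U & q in U].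

Definition diam_pow (s : R) (U : set (plane R)) : \bar R :=
  if U == set0 then 0%E else (diam U `^ s)%E.

Definition hausdorff_premeasure (s delta : R) (A : set (plane R)) : \bar R :=
  ereal_inf [set (\sum_(0 <= i <oo) diam_pow s (U i))%E |
    U in [set U : nat -> set (plane R) |
      A `<=` \bigcup_i U i /\ forall i, (diam (U i) <= delta%:E)%E]].

(* hausdorff_premeasure is nonincreasing in delta, so that its limit as delta
   tends to 0 from above is a supremum. *)
Definition hausdorff_measure (s : R) (A : set (plane R)) : \bar R :=
  ereal_sup [set hausdorff_premeasure s delta A |
    delta in [set delta : R | 0 < delta]].

Definition hausdorff_dim (A : set (plane R)) : \bar R :=
  ereal_inf [set s%:E | s in [set s : R | 0 <= s /\ hausdorff_measure s A = 0%E]].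

End hausdorff.

Section ergodic.
Context {R : realType} {d : measure_display} {T : measurableType d}.

(* A Borel probability measure on the measurable subset X is represented by a
   probability on T that gives mass 1 to X, and a self-map of X by a map f on T
   of which only the restriction to X is used. *)

Definition invariant_on (X : set T) (f : T -> T) (mu : probability T R) : Prop :=
  forall B, measurable B -> B `<=` X -> mu (X `&` f @^-1` B) = mu B.

Definition ergodic_on (X : set T) (f : T -> T) (mu : probability T R) : Prop :=
  [/\ mu X = 1%E, invariant_on X f mu &
      forall B, measurable B -> B `<=` X -> X `&` f @^-1` B = B ->
        mu B = 0%E \/ mu B = 1%E].

End ergodic.

Section baker.
Context {R : realType}.

Definition square : set (plane R) := `[-1, 1]%classic `*` `[-1, 1]%classic.

Definition baker (b1 b2 : R) (p : plane R) : plane R :=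
  if 0 <= p.2 then (b1 * p.1 + (1 - b1), 2 * p.2 - 1)
  else (b2 * p.1 - (1 - b2), 2 * p.2 + 1).

Definition measure_dim (mu : probability (plane R) R) : \bar R :=
  ereal_inf [set hausdorff_dim B |
    B in [set B | [/\ measurable B, B `<=` square & mu B = 1%E]]].

End baker.

(* Main.v *)
Require Import Defs.
From HB Require Import structures.
From mathcomp Require Import all_boot all_order all_algebra.
From mathcomp Require Import all_classical all_reals all_analysis.
From mathcomp Require Import measurable_realfun ring lra.

Import Order.TTheory GRing.Theory Num.Theory.
Import numFieldNormedType.Exports.

Local Open Scope classical_set_scope.
Local Open Scope ring_scope.

(** Code a point of the square by the signs of the second coordinates along its
    orbit (its digits), and let p be the probability of the digit y >= 0. Two
    points whose first n digits agree have second coordinates within 2 / 2 ^ n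
    of each other; and the first coordinate of the n-th image of a point with
    digits w lies in an interval whose half-length is the product of the
    contraction factors b d over the digits d of w. The dimension of an ergodic
    measure drops below 2 for one of two reasons, according to p.

    If p is at distance at least delta from 1/2, then almost every orbit has,
    for infinitely many n, an excess of one digit among its first n digits. By
    a Chernoff bound the number of words with such an excess is at most
    theta ^ n with theta < 2, so the second coordinates lie in a limsup set of
    dimension at most log theta / log 2 < 1
    ([measure_dim_le_forward]).

    If p is within delta of 1/2, then the mean of - ln (b d) exceeds some
    kappa > ln 2, because b1 * b2 < 1/4. Almost every point then lies, for
    infinitely many n, in one of at most 2 ^ n vertical strips of width
    2 * expR (- kappa) ^ n, so the first coordinates lie in a limsup set of
    dimension at most ln 2 / kappa < 1 ([measure_dim_le_backward]).

    In both cases the other coordinate ranges over an interval and adds at most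
    1 to the dimension ([hausdorff_dim_limsup_strips]). As delta, theta and kappa
    depend only on b1 and b2, the bound on the dimension is uniform.

    The almost sure statements come from the mean alone. If a function phi of
    the digits has positive mean, then sums of n values of phi along the orbit
    have mean growing linearly in n and are at most of order n, so they exceed
    any given bound with probability at least a fixed c > 0 once n is large
    ([measure_birkhoff_sum_ge]). Hence the set where these sums are unbounded
    has measure at least c. Baker's map sends that set into itself, so by
    ergodicity it has measure 1 ([ergodic_forward_invariant]). The same argument
    applies to the sums over the digits of the past, which are what the strips
    record; the map is not injective where the two images overlap, so the past
    is represented by all words whose strip contains the point. *)

(** * Coverings and Hausdorff dimension *)

Section covers.
Context {R : realType}.
Implicit Types (s delta c C e : R) (A U : set (plane R)).

Lemma eucl_dist_le_add (p q : plane R) :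
  eucl_dist p q <= `|p.1 - q.1| + `|p.2 - q.2|.
Proof.
rewrite /eucl_dist -[leRHS]ger0_norm ?addr_ge0// -sqrtr_sqr ler_wsqrtr//.
rewrite -(real_normK (num_real (p.1 - q.1))) -(real_normK (num_real (p.2 - q.2))).
have := normr_ge0 (p.1 - q.1); have := normr_ge0 (p.2 - q.2).
set x := `|p.1 - q.1|; set y := `|p.2 - q.2| => y0 x0; nra.
Qed.

Lemma diam_set0 : diam (set0 : set (plane R)) = -oo%E.
Proof.
by rewrite /diam -[RHS]ereal_sup0; congr ereal_sup; apply/seteqP; split => x // [p []].
Qed.

Lemma diam_le U c : (forall p q, U p -> U q -> eucl_dist p q <= c) ->
  (diam U <= c%:E)%E.
Proof.
by move=> Uc; apply: ge_ereal_sup => _ [p Up] [q Uq] <-; rewrite lee_fin Uc.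
Qed.

Lemma diam_pow_ge0 s U : (0 <= diam_pow s U)%E.
Proof. by rewrite /diam_pow; case: ifP => // _; exact: poweR_ge0. Qed.

Lemma diam_pow_le s c U : 0 <= s ->
  (forall p q, U p -> U q -> eucl_dist p q <= c) ->
  (diam_pow s U <= (c `^ s)%:E)%E.
Proof.
move=> s0 Uc; rewrite /diam_pow; case: ifPn => [_|/set0P[p Up]].
  by rewrite lee_fin powR_ge0.
rewrite -poweR_EFin; have dUc := diam_le _ _ Uc.
have dU0 : (0 <= diam U)%E.
  apply: ereal_sup_ubound; exists p => //; exists p => //.
  by rewrite /eucl_dist !subrr expr0n/= addr0 sqrtr0.
apply: gt0_ler_poweR => //; rewrite in_itv/= leey andbT //.
exact: le_trans dUc.
Qed.

Lemma hausdorff_premeasure_ge0 s delta A : (0 <= hausdorff_premeasure s delta A)%E.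
Proof.
apply: le_ereal_inf_tmp => _ [U _ <-]; apply: nneseries_ge0 => n _ _.
exact: diam_pow_ge0.
Qed.

(** The premeasure is an infimum over covers indexed by the natural numbers; a
    sequence of finite lists of covering sets is turned into such a cover by
    concatenating the lists. *)
Lemma hausdorff_premeasure_le_cover (I : eqType) (L : nat -> seq I)
    (V : nat -> I -> set (plane R)) s delta A (a : nat -> R) e :
  (forall n i, (diam (V n i) <= delta%:E)%E) ->
  A `<=` [set p | exists n i, i \in L n /\ V n i p] ->
  (forall n, (\sum_(i <- L n) diam_pow s (V n i) <= (a n)%:E)%E) ->
  (forall k, \sum_(0 <= n < k) a n <= e) ->
  (hausdorff_premeasure s delta A <= e%:E)%E.
Proof.
move=> Vdelta AV sumV sume.
(* Each list receives one extra entry None, standing for the empty set, so that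
   the first k lists together have at least k entries. *)
pose T n : seq (option (nat * I)) := None :: [seq Some (n, i) | i <- L n].
pose F k := flatten (mkseq T k).
pose g (x : option (nat * I)) := oapp (fun ni => V ni.1 ni.2) set0 x.
pose U k := g (nth None (F k.+1) k).
have FS k : F k.+1 = F k ++ T k by rewrite /F mkseqS flatten_rcons.
have leF k : (k <= size (F k))%N.
  elim: k => // k IH; rewrite FS size_cat/= addnS ltnS.
  exact: leq_trans IH (leq_addr _ _).
have nthF i k m : (i < size (F k))%N -> (k <= m)%N ->
    nth None (F m) i = nth None (F k) i.
  move=> ik; elim: m => [|m IH]; first by rewrite leqn0 => /eqP ->.
  rewrite leq_eqVlt => /predU1P[->//|]; rewrite ltnS => km.
  rewrite FS nth_cat IH// ifT//; apply: (leq_trans ik).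
  rewrite -(subnKC km); elim: (m - k)%N => [|j IHj]; first by rewrite addn0.
  by rewrite addnS FS size_cat; exact: leq_trans IHj (leq_addr _ _).
have UE i m : (i < m)%N -> U i = g (nth None (F m) i).
  by move=> im; rewrite /U -(nthF i i.+1 m)//; exact: leF.
apply: (@le_trans _ _ (\sum_(0 <= i <oo) diam_pow s (U i))%E).
  apply: ereal_inf_lbound; exists U => //; split.
    move=> p /AV[n [i [iL Vp]]].
    have xF : Some (n, i) \in F n.+1.
      rewrite FS mem_cat inE map_f ?orbT//=; exact/orP/or_intror.
    exists (index (Some (n, i)) (F n.+1)) => //.
    set j := index _ _; have jF : (j < size (F n.+1))%N by rewrite index_mem.
    rewrite (UE j (maxn j.+1 n.+1)) ?leq_max ?leqnn//.
    by rewrite (nthF _ n.+1) ?leq_max ?leqnn ?orbT// nth_index.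
  move=> k; rewrite /U; case: (nth _ _ _) => [[n i]|]/=; first exact: Vdelta.
  by rewrite diam_set0 leNye.
apply: lime_le; first by apply: is_cvg_nneseries => n _ _; exact: diam_pow_ge0.
apply: nearW => k.
rewrite (@eq_big_nat _ _ _ _ _ _ (fun i => diam_pow s (g (nth None (F k) i)))); last first.
  by move=> i /andP[_ ik]; rewrite (UE i k).
apply: (@le_trans _ _ (\sum_(x <- F k) diam_pow s (g x))%E).
  rewrite [leRHS](big_nth None) [leRHS](@big_cat_nat _ _ _ k)//=.
  rewrite leeDl// sume_ge0// => i _; exact: diam_pow_ge0.
rewrite /F big_flatten/= /mkseq big_map.
apply: (@le_trans _ _ (\sum_(0 <= n < k) (a n)%:E)%E); last first.
  by rewrite sumEFin lee_fin.
rewrite /index_iota subn0; apply: lee_sum => n _.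
rewrite /T big_cons/= big_map/= {1}/diam_pow eqxx add0e; exact: sumV.
Qed.

(** A limsup set is covered by all the pieces of levels beyond any N, which cost
    at most a tail of the geometric series of ratio q * r `^ s. *)
Lemma hausdorff_measure_limsup (I : eqType) (L : nat -> seq I)
    (V : nat -> I -> set (plane R)) s A C c (r q : R) :
  0 <= s -> 0 <= C -> 0 < c -> 0 < r < 1 -> 0 <= q -> q * r `^ s < 1 ->
  (forall n, (size (L n))%:R <= C * q ^+ n) ->
  (forall n i p p', V n i p -> V n i p' -> eucl_dist p p' <= c * r ^+ n) ->
  A `<=` [set p | forall N, exists2 n, (N <= n)%N &
                    exists i, i \in L n /\ V n i p] ->
  hausdorff_measure s A = 0%E.
Proof.
move=> s0 C0 c0 /andP[r0 r1] q0 qr1 sizeL diamV AV.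
set rho := q * r `^ s in qr1 *.
have rho0 : 0 <= rho by rewrite mulr_ge0// powR_ge0.
suff premeasure0 delta : 0 < delta -> hausdorff_premeasure s delta A = 0%E.
  rewrite /hausdorff_measure.
  rewrite (_ : [set _ | _ in _] = [set 0%E]) ?ereal_sup1//.
  apply/seteqP; split => [_ [delta /= delta0 <-]|_ ->]/=.
    by rewrite premeasure0.
  by exists 1 => //=; rewrite premeasure0.
move=> delta0; apply/eqP; rewrite eq_le hausdorff_premeasure_ge0 andbT.
apply/lee_addgt0Pr => e e0; rewrite add0e.
have [N1 _ N1c] : \forall n \near \oo, c * r ^+ n < delta.
  have : geometric c r @ \oo --> 0.
    by apply: cvg_geometric; rewrite ger0_norm// ltW.
  move/cvgrPdist_lt => /(_ _ delta0); apply: filterS => n /=.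
  by rewrite sub0r normrN; apply: le_lt_trans; exact: ler_norm.
pose C' := C * c `^ s / (1 - rho).
have [N2 _ N2e] : \forall n \near \oo, C' * rho ^+ n < e.
  have : geometric C' rho @ \oo --> 0.
    by apply: cvg_geometric; rewrite ger0_norm// ltW.
  move/cvgrPdist_lt => /(_ _ e0); apply: filterS => n /=.
  by rewrite sub0r normrN; apply: le_lt_trans; exact: ler_norm.
pose N := maxn N1 N2.
apply: (hausdorff_premeasure_le_cover _ (fun n => L (N + n)%N)
  (fun n => V (N + n)%N) _ _ _ (fun n => C * c `^ s * rho ^+ (N + n)%N)).
- move=> n i; apply: (@le_trans _ _ (c * r ^+ (N + n)%N)%:E).
    by apply: diam_le => p p' Vp Vp'; exact: diamV Vp Vp'.
  rewrite lee_fin ltW// N1c//=; apply: leq_trans (leq_addr _ _).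
  exact: leq_maxl.
- move=> p /AV /(_ N)[n Nn [i iL]]; exists (n - N)%N, i; rewrite subnKC//.
- move=> n; apply: (@le_trans _ _
      (\sum_(i <- L (N + n)%N) ((c * r ^+ (N + n)%N) `^ s)%:E)%E).
    by apply: lee_sum => i _; apply: diam_pow_le => // p p' Vp Vp'; exact: diamV Vp Vp'.
  rewrite sumEFin lee_fin big_const_seq count_predT iter_addr_0 -mulr_natl.
  rewrite powRM ?exprn_ge0 ?(ltW r0) ?(ltW c0)//.
  have -> : (r ^+ (N + n)%N) `^ s = (r `^ s) ^+ (N + n)%N.
    by rewrite -!powR_mulrn ?powR_ge0 ?(ltW r0)// -!powRrM mulrC.
  rewrite /rho exprMn_comm; last exact: mulrC.
  rewrite [leRHS](_ : _ = (C * q ^+ (N + n)%N) * (c `^ s * (r `^ s) ^+ (N + n)%N)).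
    by rewrite ler_wpM2r ?sizeL// mulr_ge0 ?powR_ge0// exprn_ge0 ?powR_ge0.
  by rewrite mulrACA.
- move=> k; apply: (@le_trans _ _ (C' * rho ^+ N)); last first.
    by rewrite ltW// N2e//= leq_maxr.
  under eq_bigr do rewrite exprD mulrA.
  rewrite -mulr_sumr /C' [leRHS]mulrAC ler_wpM2l//.
    by rewrite !mulr_ge0 ?powR_ge0 ?exprn_ge0.
  rewrite big_mkord -[leRHS]mul1r ler_pdivlMr ?subr_gt0// mulrC.
  by rewrite -[1 - rho]opprB mulNr -subrX1 opprB gerBl exprn_ge0.
Qed.
End covers.

Section strips.
Context {R : realType}.

(** Each strip of level n is cut along v into at most 2 / r ^ n pieces of
    diameter at most 4 * r ^ n; there are thus of the order of (theta / r) ^ n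
    pieces of level n. Here (u, v) stands for the two coordinates in either
    order. *)
Lemma hausdorff_dim_limsup_strips (I : eqType) (W : nat -> seq I)
    (V : nat -> I -> set (plane R)) (u v : plane R -> R) (A : set (plane R))
    (r theta s : R) :
  (forall p q, eucl_dist p q <= `|u p - u q| + `|v p - v q|) ->
  0 < r < 1 -> 0 <= theta -> 0 <= s -> theta / r * r `^ s < 1 ->
  (forall n, (size (W n))%:R <= theta ^+ n) ->
  (forall n i p q, V n i p -> V n i q -> `|u p - u q| <= 2 * r ^+ n) ->
  (forall p, A p -> -1 <= v p <= 1) ->
  A `<=` [set p | forall N, exists2 n, (N <= n)%N &
                    exists i, i \in W n /\ V n i p] ->
  (hausdorff_dim A <= s%:E)%E.
Proof.
move=> distuv /andP[r0 r1] theta0 s0 qr1 sizeW uV Av AV.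
have rn0 n : 0 < r ^+ n by rewrite exprn_gt0.
apply: ereal_inf_lbound; exists s => //=; split => //.
pose height n p := Num.truncn ((v p + 1) / (2 * r ^+ n)).
pose K n := (Num.truncn ((r ^+ n)^-1)).+1.
apply: (@hausdorff_measure_limsup _ _
   (fun n => [seq (i, j) | i <- W n, j <- iota 0 (K n)])
   (fun n ij => [set p | [/\ V n ij.1 p, -1 <= v p <= 1 & height n p = ij.2]])
   s A 2 4 r (theta / r)) => //.
- by apply/andP.
- by rewrite divr_ge0// ltW.
- move=> n; rewrite size_allpairs size_iota natrM expr_div_n mulrCA.
  apply: ler_pM => //.
  have : 1 <= (r ^+ n)^-1 by rewrite invf_ge1// exprn_ile1// ltW.
  have : (Num.truncn (r ^+ n)^-1)%:R <= (r ^+ n)^-1 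
    by have /truncn_itv/andP[] : 0 <= (r ^+ n)^-1 by rewrite invr_ge0 ltW.
  rewrite /K -natr1; lra.
- move=> n [i j] p q /= [Vp vp hp] [Vq vq hq].
  apply: (le_trans (distuv _ _)).
  have := uV _ _ _ _ Vp Vq.
  suff : `|v p - v q| <= 2 * r ^+ n by lra.
  have h0 x : -1 <= v x -> 0 <= (v x + 1) / (2 * r ^+ n).
    by move=> vx; rewrite divr_ge0 ?mulr_ge0 ?(ltW (rn0 n))//; lra.
  have /andP[vp1 vp2] := vp; have /andP[vq1 vq2] := vq.
  have := truncn_itv (h0 _ vp1); have := truncn_itv (h0 _ vq1).
  rewrite -/(height n p) -/(height n q) hp hq -natr1.
  have k0 : 0 < 2 * r ^+ n by rewrite mulr_gt0.
  rewrite !ler_pdivlMr// !ltr_pdivrMr// mulrDl mul1r.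
  move=> /andP[? ?] /andP[? ?]; rewrite ler_norml; apply/andP; split; lra.
- move=> p Ap N; have [n Nn [i [iW Vp]]] := AV p Ap N.
  have /andP[v1 v2] := Av p Ap; exists n => //.
  exists (i, height n p); split; last by split=> //; apply/andP.
  apply: allpairs_f => //; rewrite mem_iota add0n leq0n ltnS/=.
  apply: le_truncn; rewrite ler_pdivrMr ?mulr_gt0// mulrCA mulVf ?gt_eqF//; lra.
Qed.

(** At s = 2 the ratio of the covering series is theta * r < 1, which leaves room
    to decrease s. *)
Lemma exists_dim_lt2 (r theta : R) : 0 < r < 1 -> 0 < theta -> theta * r < 1 ->
  exists s, [/\ 0 <= s, s < 2 & theta / r * r `^ s < 1].
Proof.
move=> /andP[r0 r1] theta0 thr.
have a0 : 0 < - ln r by rewrite oppr_gt0 ln_lt0// r0.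
have b0 : 0 < - ln (theta * r) by rewrite oppr_gt0 ln_lt0// thr mulr_gt0.
have bE : ln (theta * r) = ln theta + ln r by rewrite lnM ?posrE.
set a := - ln r in a0; set b := - ln (theta * r) in b0.
(* With b = - ln (theta * r), the logarithm of the ratio at s = 2 - eps is
   - b + eps * a, and the second bound on eps makes it at most - b / 2. *)
pose eps := Num.min 1 (b / (2 * a)).
have eps0 : 0 < eps by rewrite lt_min ltr01 divr_gt0// mulr_gt0.
have eps1 : eps <= 1 by rewrite ge_min lexx.
have epsb : eps * (2 * a) <= b.
  by rewrite -ler_pdivlMr ?mulr_gt0// ge_min lexx orbT.
exists (2 - eps); split; [lra|lra|].
rewrite -[X in X / r]lnK ?posrE// -[X in _ / X]lnK ?posrE//.
rewrite /powR gt_eqF// -expRN -!expRD expR_lt1.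
rewrite /a /b bE in epsb b0 a0; nra.
Qed.
End strips.

(** * Words, itineraries and strips *)

Section words.
Context {R : realType}.
Implicit Types (phi : bool -> R) (w : seq bool).

Fixpoint words n : seq (seq bool) :=
  if n is m.+1 then map (cons true) (words m) ++ map (cons false) (words m)
  else [:: [::]].

Lemma mem_words n w : (w \in words n) = (size w == n).
Proof.
elim: n w => [|n IH] [|d w] //=; rewrite mem_cat.
  by apply/negbTE/norP; split; apply/mapP => -[].
have consE e : (d :: w \in map (cons e) (words n)) = (d == e) && (w \in words n).
  apply/mapP/andP => [[w' w'n [-> ->]]|[/eqP -> wn]]; first by rewrite eqxx.
  by exists w.
by rewrite !consE IH eqSS; case: d {consE}; rewrite ?orbF.
Qed.

Lemma size_words n : size (words n) = (2 ^ n)%N.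
Proof. by elim: n => //= n IH; rewrite size_cat !size_map IH addnn -mul2n expnS. Qed.

Definition weight phi w : R := \sum_(d <- w) phi d.

Lemma sum_expR_weight phi n :
  \sum_(w <- words n) expR (weight phi w) =
  (expR (phi true) + expR (phi false)) ^+ n.
Proof.
elim: n => [|n IH] /=; first by rewrite big_seq1 /weight big_nil expR0.
rewrite big_cat/= !big_map exprS mulrDl -IH !mulr_sumr.
by congr +%R; apply: eq_bigr => w _; rewrite /weight big_cons expRD.
Qed.

(** Chernoff bound: the indicator of 0 <= weight phi w is at most
    expR (weight phi w). *)
Lemma size_words_weight_ge0 phi n :
  (size [seq w <- words n | 0 <= weight phi w])%:R <=
  (expR (phi true) + expR (phi false)) ^+ n.
Proof.
rewrite -sum_expR_weight size_filter -sum1_count natr_sum.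
rewrite [leLHS]big_mkcond/=; apply: ler_sum => w _.
case: ifPn => [w0|_]; last exact: expR_ge0.
by rewrite -[leLHS]expR0 ler_expR.
Qed.

Lemma weight_le phi K w : (forall d, phi d <= K) -> weight phi w <= K *+ size w.
Proof.
move=> phiK; elim: w => [|d w IH]; first by rewrite /weight big_nil mulr0n.
by rewrite /weight big_cons mulrS lerD.
Qed.

End words.

Section itinerary.
Context {R : realType} (b : bool -> R).
Implicit Types (z : plane R) (w : seq bool).

Definition digit z : bool := 0 <= z.2.

Local Notation f := (baker (b true) (b false)).

Fixpoint itinerary n z : seq bool :=
  if n is m.+1 then digit z :: itinerary m (f z) else [::].

Lemma size_itinerary n z : size (itinerary n z) = n.
Proof. by elim: n z => //= n IH z; rewrite IH. Qed.

Definition shift (d : bool) : R := if d then 1 - b true else - (1 - b false).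

Lemma baker1 z : (f z).1 = b (digit z) * z.1 + shift (digit z).
Proof. by rewrite /baker /digit /shift; case: ifP. Qed.

Lemma baker2 z : (f z).2 = 2 * z.2 + (if digit z then -1 else 1).
Proof. by rewrite /baker /digit; case: ifP. Qed.


(** The first coordinate after the branches with digits w, read from the head,
    have been applied to a point of first coordinate c. The image of `[-1, 1] is
    the interval of centre [centre w 0] and half-length [word_ratio w]. *)
Fixpoint centre w (c : R) : R :=
  if w is d :: w' then centre w' (b d * c + shift d) else c.

Definition word_ratio w : R := \prod_(d <- w) b d.

Definition strip w : set (plane R) :=
  [set z | `|z.1 - centre w 0| <= word_ratio w].

Lemma centreE w c : centre w c = centre w 0 + word_ratio w * c.
Proof.
rewrite /word_ratio; elim: w c => [|d w IH] c /=; first by rewrite big_nil mul1r add0r.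
by rewrite IH [in RHS]IH big_cons; ring.
Qed.

Lemma centre_rcons w d c : centre (rcons w d) c = b d * centre w c + shift d.
Proof. by elim: w c => //= e w IH c; rewrite IH. Qed.

Lemma iter_baker1 n z : (iter n f z).1 = centre (itinerary n z) z.1.
Proof. by elim: n z => // n IH z; rewrite iterSr IH baker1. Qed.

Hypothesis b01 : forall d, 0 < b d < 1.

Let b0 d : 0 < b d. Proof. by have /andP[] := b01 d. Qed.

Lemma word_ratio_gt0 w : 0 < word_ratio w.
Proof. by rewrite /word_ratio prodr_gt0. Qed.

Lemma strip_iter n z : `|z.1| <= 1 -> strip (itinerary n z) (iter n f z).
Proof.
move=> z1; rewrite /strip/= iter_baker1 centreE addrC addKr normrM.
by rewrite gtr0_norm ?word_ratio_gt0// ler_piMr// ltW ?word_ratio_gt0.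
Qed.

Lemma strip_baker w z : strip w z -> strip (rcons w (digit z)) (f z).
Proof.
rewrite /strip/= baker1 centre_rcons opprD addrACA subrr addr0 -mulrBr normrM.
rewrite (gtr0_norm (b0 _)) => wz.
rewrite /word_ratio -cats1 big_cat big_seq1/= [leLHS]mulrC.
by rewrite ler_wpM2r// ltW.
Qed.

Lemma strip_width w p q : strip w p -> strip w q ->
  `|p.1 - q.1| <= 2 * word_ratio w.
Proof.
rewrite /strip/= => wp; rewrite distrC => wq.
by have := ler_distD (centre w 0) p.1 q.1; lra.
Qed.

(** For this phi, weight phi w = - ln (word_ratio w) - kappa * size w. *)
Lemma word_ratio_le kappa w : 0 <= weight (fun d => - ln (b d) - kappa) w ->
  word_ratio w <= expR (- kappa) ^+ size w.
Proof.
suff -> : word_ratio w =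
    expR (- weight (fun d => - ln (b d) - kappa) w) * expR (- kappa) ^+ size w.
  by move=> w0; rewrite ler_piMl ?exprn_ge0 ?expR_ge0// -[leRHS]expR0 ler_expR oppr_le0.
rewrite /word_ratio /weight; elim: w => [|d w IH]/=.
  by rewrite !big_nil oppr0 expR0 mul1r.
rewrite !big_cons IH exprS opprD expRD opprB mulrACA -expRD.
by rewrite opprK addrAC subrr add0r lnK ?posrE.
Qed.

Lemma squareP z : square z <-> (-1 <= z.1 <= 1) /\ (-1 <= z.2 <= 1).
Proof. by rewrite /square/= !in_itv. Qed.

Lemma baker_square z : square z -> square (f z).
Proof.
move=> /squareP[/andP[x0 x1] /andP[y0 y1]]; apply/squareP.
rewrite baker1 baker2 /digit /shift.
case: (leP 0 z.2) => y; have /andP[? ?] := b01 true; have /andP[? ?] := b01 false;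
  split; apply/andP; split; first [lra | nra].
Qed.

Lemma iter_baker_square n z : square z -> square (iter n f z).
Proof. by move=> z0; elim: n => //= n; exact: baker_square. Qed.

(** The map doubles the difference of second coordinates as long as the digits
    agree, and the images stay in the square. *)
Lemma itinerary_dist n p q : square p -> square q ->
  itinerary n p = itinerary n q -> `|p.2 - q.2| <= 2 * 2^-1 ^+ n.
Proof.
elim: n p q => [|n IH] p q sp sq.
  have /squareP[_ /andP[? ?]] := sp; have /squareP[_ /andP[? ?]] := sq.
  by rewrite expr0 mulr1 => _; rewrite ler_norml; apply/andP; split; lra.
move=> [dpq /IH] /(_ (baker_square _ sp) (baker_square _ sq)).
rewrite !baker2 dpq opprD addrACA subrr addr0 -mulrBr normrM ger0_norm//.
by rewrite exprS; lra.
Qed.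

End itinerary.

(** * Ergodicity and unbounded sums *)

Section ergodic_sets.
Context {R : realType} {d : measure_display} {T : measurableType d}.
Variables (X : set T) (f : T -> T) (mu : probability T R).
Hypothesis mX : measurable X.
Hypothesis mf : measurable_fun setT f.
Hypothesis fX : forall z, X z -> X (f z).
Hypothesis muf : ergodic_on X f mu.

Lemma measurable_iter_preimage n B : measurable B -> measurable (iter n f @^-1` B).
Proof.
move=> mB; elim: n => //= n IH.
rewrite (_ : _ @^-1` B = f @^-1` (iter n f @^-1` B)); last first.
  by apply/seteqP; split => z; rewrite /= -iterSr.
by rewrite -[X in measurable X]setTI; exact: mf.
Qed.

Let iterX n z : X z -> X (iter n f z).
Proof. by move=> Xz; elim: n => //= n; exact: fX. Qed.

Lemma invariant_iter n B : measurable B -> B `<=` X ->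
  mu (X `&` iter n f @^-1` B) = mu B.
Proof.
move=> mB BX; elim: n => [|n IH]; first by congr (mu _); apply/setIidr.
have [_ inv _] := muf; rewrite -IH -[RHS]inv; last 2 first.
- by apply: measurableI => //; exact: measurable_iter_preimage.
- exact: subIsetl.
congr (mu _); apply/seteqP; split => z [Xz] /=; rewrite -iterSr => Bz; split => //=.
  by split; [exact: fX|].
by case: Bz.
Qed.

(** The preimages of a set Z that f maps into itself increase and all have the
    measure of Z; their union Y is exactly invariant, so that ergodicity applies
    to it. *)
Lemma ergodic_forward_invariant Z : measurable Z -> Z `<=` X ->
  Z `<=` f @^-1` Z -> (0 < mu Z)%E -> mu Z = 1%E.
Proof.
move=> mZ ZX Zf Z0.
pose F n := X `&` iter n f @^-1` Z; pose Y := \bigcup_n F n.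
have mF n : measurable (F n) by apply: measurableI => //; exact: measurable_iter_preimage.
have mY : measurable Y by exact: bigcup_measurable.
have YX : Y `<=` X by move=> z [n _ []].
have FS n : F n `<=` F n.+1 by move=> z [Xz /Zf Zz]; split.
have YE : mu Y = mu Z.
  have : (mu \o F) n @[n --> \oo] --> mu Y.
    by apply: nondecreasing_cvg_mu => //; apply/nondecreasing_seqP => n; apply/subsetPset.
  have -> : mu \o F = fun=> mu Z by apply/funext => n /=; exact: invariant_iter.
  by move/cvg_lim => <- //; rewrite lim_cst.
have Yinv : X `&` f @^-1` Y = Y.
  apply/seteqP; split => z.
    by move=> [Xz [n _ [_ /= Zn]]]; exists n.+1 => //; split => //=; rewrite -iterS iterSr.
  move=> [n _ [Xz Zn]]; split => //; exists n => //; split; first exact: fX.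
  by rewrite /= -iterSr; exact: Zf.
have [_ _ erg] := muf.
by rewrite -YE; case: (erg Y mY YX Yinv) => // Y0; rewrite -YE Y0 ltxx in Z0.
Qed.

(** How a bound in probability, uniform in M, passes to the set of points where a
    sequence is unbounded: the n that achieves it may depend on M, but the unions
    over n decrease with M. *)
Lemma measure_bigcap_bigcup_ge (E : nat -> nat -> set T) (c : R) :
  (forall M n, measurable (E M n)) ->
  (forall M n, E M.+1 n `<=` E M n) ->
  (forall M, exists n, (c%:E <= mu (E M n))%E) ->
  (c%:E <= mu (\bigcap_M \bigcup_n E M n))%E.
Proof.
move=> mE ES Ec; pose F M := \bigcup_n E M n.
have mF M : measurable (F M) by exact: bigcup_measurable.
have muF : (mu \o F) M @[M --> \oo] --> mu (\bigcap_M F M).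
  apply: nonincreasing_cvg_mu => //.
  - by rewrite (le_lt_trans (probability_le1 _ _))// ltry.
  - exact: bigcap_measurable.
  - apply/nonincreasing_seqP => M; apply/subsetPset => z [n _ Ez].
    by exists n => //; exact: ES.
rewrite -(cvg_lim _ muF)//; apply: lime_ge; first by apply/cvg_ex; eexists; exact: muF.
apply: nearW => M; have [n cn] := Ec M.
by apply: (le_trans cn); apply: le_measure; rewrite ?inE// => z Ez; exists n.
Qed.


Variable bit : T -> bool.
Hypothesis mbit : measurable [set z | bit z].

Definition birkhoff_sum (phi : bool -> R) n z : R :=
  \sum_(0 <= i < n) phi (bit (iter i f z)).

Let mbitn n : measurable [set z | bit (iter n f z)].
Proof. exact: measurable_iter_preimage mbit. Qed.

Lemma measurable_birkhoff_sum phi n : measurable_fun setT (birkhoff_sum phi n).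
Proof.
apply: measurable_sum => i.
rewrite (_ : (fun z => _) = fun z => if bit (iter i f z) then phi true else phi false).
  apply: measurable_fun_ifT => //; apply: (measurable_fun_bool true).
  by rewrite setTI (_ : _ @^-1` _ = [set z | bit (iter i f z)])//.
by apply/funext => z; case: bit.
Qed.

Lemma measurable_birkhoff_sum_ge phi n (M : R) :
  measurable [set z | M <= birkhoff_sum phi n z].
Proof.
rewrite (_ : [set z | _] = birkhoff_sum phi n @^-1` `[M, +oo[).
  by rewrite -[X in measurable X]setTI; exact: measurable_birkhoff_sum.
by apply/seteqP; split => z /=; rewrite in_itv/= andbT.
Qed.

Lemma birkhoff_sum_le phi K n z : (forall e, phi e <= K) ->
  birkhoff_sum phi n z <= n%:R * K.
Proof.
move=> phiK; apply: (@le_trans _ _ (\sum_(0 <= i < n) K)); first exact: ler_sum.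
by rewrite big_const_nat subn0 iter_addr_0 mulr_natl.
Qed.

Let p : R := fine (mu (X `&` [set z | bit z])).

(** Reverse Markov inequality. The sum of n terms has mean at least n * m and is
    at most n * K, so it is at least M with probability at least about m / K once
    n * m is at least 2 * M. The proof integrates the nonnegative function
    obtained by adding K to each term. *)
Lemma measure_birkhoff_sum_ge phi (K m M : R) :
  (forall e, `|phi e| <= K) ->
  0 < m -> m <= phi true * p + phi false * (1 - p) -> 0 <= M ->
  exists n, ((m / (4 * K))%:E <= mu (X `&` [set z | (M <= birkhoff_sum phi n z)%R]))%E.
Proof.
move=> phiK m0 mp M0.
have muX : mu X = 1%E by case: muf.
pose A i := X `&` [set z | bit (iter i f z)].
have mA i : measurable (A i) by apply: measurableI.
have muA i : mu (A i) = p%:E.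
  rewrite fineK ?fin_num_measure//; last exact: measurableI.
  rewrite -[RHS](@invariant_iter i)//; last exact: measurableI.
  by congr (mu _); apply/seteqP; split => z [Xz] => [zi|[]]; split => //; split => //; exact: iterX.
have muAC i : mu (X `\` A i) = (1 - p)%:E.
  rewrite measureD//; last by rewrite -ge0_fin_numE// fin_num_measure.
  have -> : X `&` A i = A i by apply: setIidr; exact: subIsetl.
  exact: (congr2 (fun x y => x - y)%E muX (muA i)).
have phiK0 e : 0 <= phi e + K.
  by rewrite -lerBlDr sub0r; have := phiK e; rewrite ler_norml => /andP[].
have phileK e : phi e <= K by rewrite (le_trans _ (phiK e))// ler_norm.
pose h i z := ((phi true + K)%:E * (\1_(A i) z)%:E +
               (phi false + K)%:E * (\1_(X `\` A i) z)%:E)%E.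
have mindic B : measurable B -> measurable_fun X (fun z => (\1_B z)%:E : \bar R).
  by move=> mB; apply/measurable_EFinP; apply: measurable_indic.
have mh i : measurable_fun X (h i).
  by apply: emeasurable_funD; apply: measurable_funeM; apply: mindic => //; exact: measurableD.
have h0 i z : X z -> (0 <= h i z)%E.
  by move=> _; rewrite adde_ge0// mule_ge0// lee_fin.
have inth i : (\int[mu]_(z in X) h i z)%E =
    (phi true * p + phi false * (1 - p) + K)%:E.
  have mAC := measurableD mX (mA i).
  rewrite ge0_integralD//; last 4 first.
  - by move=> z _; rewrite mule_ge0// lee_fin.
  - by apply: measurable_funeM; exact: mindic.
  - by move=> z _; rewrite mule_ge0// lee_fin.
  - by apply: measurable_funeM; exact: mindic.
  rewrite !ge0_integralZl ?lee_fin//; do ?[by apply: mindic].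
  rewrite !integral_indic// (_ : A i `&` X = A i); last by rewrite setIidl//; exact: subIsetl.
  rewrite (_ : (X `\` A i) `&` X = X `\` A i); last by rewrite setIidl//; exact: subIsetl.
  rewrite [X in (_ * X + _)%E](muA i) [X in (_ + _ * X)%E](muAC i) -!EFinM -EFinD; congr EFin; ring.
pose n := (Num.truncn (2 * M / m)).+1.
have nM : 2 * M <= n%:R * m.
  by rewrite -ler_pdivrMr// ltW// truncnS_gt.
have n0 : 0 < n%:R :> R by rewrite ltr0n.
exists n; set E := X `&` _.
have mE : measurable E by apply: measurableI => //; exact: measurable_birkhoff_sum_ge.
have K0 : 0 < K.
  have p0 : 0 <= p by rewrite fine_ge0.
  have p1 : p <= 1.
    by rewrite -lee_fin -(muA 0%N) probability_le1//.
  have := phileK true; have := phileK false; nra.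
have hE z : X z -> (\sum_(0 <= i < n) h i z)%E = (birkhoff_sum phi n z + n%:R * K)%:E.
  move=> Xz; rewrite (_ : n%:R * K = \sum_(0 <= i < n) K); last first.
    by rewrite big_const_nat subn0 iter_addr_0 mulr_natl.
  rewrite /birkhoff_sum -big_split/= -sumEFin; apply: eq_bigr => i _.
  rewrite /h !indicE; have [biti|biti] := boolP (bit (iter i f z)).
    rewrite (_ : z \in A i); last by rewrite inE.
    rewrite (_ : z \in X `\` A i = false); last by apply/negbTE; rewrite notin_setE => -[_]; apply.
    by rewrite mule1 mule0 adde0.
  rewrite (_ : z \in A i = false); last first.
    by apply/negbTE; rewrite notin_setE => -[_ /=]; exact/negP.
  rewrite (_ : z \in X `\` A i); last by rewrite inE; split => // -[_ /=]; exact/negP.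
  by rewrite mule1 mule0 add0e.
have : (\int[mu]_(z in X) (\sum_(0 <= i < n) h i z) <=
    \int[mu]_(z in X) ((M + n%:R * K)%:E * (\1_X z)%:E + (2 * n%:R * K)%:E * (\1_E z)%:E))%E.
  apply: ge0_le_integral => //.
  - by move=> z Xz; apply: sume_ge0 => i _; exact: h0.
  - exact: emeasurable_sum.
  - by apply: emeasurable_funD; apply: measurable_funeM; exact: mindic.
  move=> z Xz; rewrite hE// -!EFinM -EFinD lee_fin !indicE mem_set// mulr1.
  have := birkhoff_sum_le phi _ n z phileK.
  have nK : 0 <= n%:R * K by rewrite mulr_ge0// ltW.
  have [zE|zE] := boolP (z \in E); first by rewrite mulr1; lra.
  rewrite mulr0 addr0 lerD2r => _; apply: ltW; rewrite ltNge; apply/negP => Mz.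
  by move: zE; rewrite notin_setE; apply; split.
rewrite ge0_integral_sum//.
under eq_bigr do rewrite inth.
rewrite ge0_integralD//; last 4 first.
- by move=> z _; rewrite mule_ge0// lee_fin addr_ge0// mulr_ge0// ltW.
- by apply: measurable_funeM; exact: mindic.
- by move=> z _; rewrite mule_ge0// lee_fin !mulr_ge0// ltW.
- by apply: measurable_funeM; exact: mindic.
rewrite !ge0_integralZl ?lee_fin//; do ?[by apply: mindic | by rewrite ?addr_ge0 ?mulr_ge0// ltW].
rewrite !integral_indic// setIid (_ : E `&` X = E); last by rewrite setIidl//; exact: subIsetl.
rewrite [X in (_ * X + _)%E]muX mule1.
rewrite sumEFin; set c := phi true * p + _ + K.
have -> : \sum_(0 <= i < n) c = n%:R * c.
  by rewrite big_const_nat subn0 iter_addr_0 mulr_natl.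
rewrite -[X in (_ + _ * X)%E](@fineK _ (mu E)) ?fin_num_measure//.
rewrite -EFinM -EFinD lee_fin => H.
rewrite -[leRHS](@fineK _ (mu E)) ?fin_num_measure// lee_fin.
move: H; rewrite /c; set e := fine _ => H.
rewrite ler_pdivrMr ?mulr_gt0//.
by rewrite -(ler_pM2l n0); nra.
Qed.

End ergodic_sets.

Section baker_measures.
Context {R : realType}.
Variable b : bool -> R.
Hypothesis b01 : forall d, 0 < b d < 1.

Local Notation f := (baker (b true) (b false)).

Lemma measurable_square : measurable (square : set (plane R)).
Proof. by apply: measurableX; exact: measurable_itv. Qed.

Lemma measurable_digit : measurable [set z : plane R | digit z].
Proof.
rewrite (_ : [set z | _] = setT `*` `[0, +oo[).
  by apply: measurableX; [exact: measurableT|exact: measurable_itv].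
by apply/seteqP; split => z; rewrite /digit/= in_itv/= andbT => // -[].
Qed.

Lemma measurable_baker : measurable_fun setT f.
Proof.
apply: measurable_fun_ifT.
- apply: (measurable_fun_bool true); rewrite setTI; exact: measurable_digit.
- apply: measurable_fun_pair; apply: measurable_funD => //; apply: measurable_funM => //.
- apply: measurable_fun_pair; apply: measurable_funD => //; apply: measurable_funM => //.
Qed.

Lemma measurable_strip w : measurable (strip b w).
Proof.
rewrite (_ : strip b w =
  `[centre b w 0 - word_ratio b w, centre b w 0 + word_ratio b w] `*` setT).
  by apply: measurableX; [exact: measurable_itv|exact: measurableT].
by apply/seteqP; split => z; rewrite /strip/= in_itv/= ler_distl => // -[].
Qed.

Lemma birkhoff_sum_itinerary (phi : bool -> R) n (z : plane R) :
  birkhoff_sum f digit phi n z = weight phi (itinerary b n z).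
Proof.
rewrite /birkhoff_sum /weight; elim: n z => [|n IH] z.
  by rewrite big_geq// big_nil.
rewrite big_nat_recl//= big_cons -IH; congr +%R.
by apply: eq_bigr => i _; rewrite -iterSr.
Qed.

(** For phi of positive mean, almost every point has unbounded sums of phi both
    over the digits of its future and over the digits of some of its possible
    pasts. *)
Section almost_everywhere.
Variable mu : probability (plane R) R.
Hypothesis muf : ergodic_on square f mu.

Let p : R := fine (mu (square `&` [set z | digit z])).

Variable phi : bool -> R.
Hypothesis mean_gt0 : 0 < phi true * p + phi false * (1 - p).

Let K : R := `|phi true| + `|phi false|.
Let phiK d : `|phi d| <= K.
Proof. by rewrite /K; case: d; rewrite ?lerDl ?lerDr. Qed.
Let phileK d : phi d <= K.
Proof. exact: le_trans (ler_norm _) (phiK d). Qed.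
Let K0 : 0 <= K. Proof. by rewrite addr_ge0. Qed.
Let k := (Num.truncn K).+1.
Let Kk : K < k%:R. Proof. exact: truncnS_gt. Qed.

Let threshold := (phi true * p + phi false * (1 - p)) / (4 * K).
Let threshold_gt0 : 0 < threshold.
Proof.
rewrite divr_gt0// mulr_gt0// lt_def K0 andbT; apply/eqP => K_eq0.
by have := mean_gt0; have := phiK true; have := phiK false;
   rewrite K_eq0 !normr_le0 => /eqP -> /eqP ->; rewrite !mul0r addr0 ltxx.
Qed.

Definition unbounded_forward : set (plane R) :=
  \bigcap_M \bigcup_n (square `&` [set z | M%:R <= weight phi (itinerary b n z)]).

(** All words whose strip contains the point are admitted as its past: this makes
    the set measurable, as a strip is closed, and f maps the set into itself, as
    the digit of the point is appended to the word. *)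
Definition unbounded_backward : set (plane R) :=
  \bigcap_M \bigcup_n (square `&`
    \bigcup_(w in [set w | w \in words n /\ M%:R <= weight phi w]) strip b w).

Let mforward (M n : nat) : measurable
  (square `&` [set z | M%:R <= weight phi (itinerary b n z)]).
Proof.
apply: measurableI; first exact: measurable_square.
under eq_set do rewrite -birkhoff_sum_itinerary.
by apply: measurable_birkhoff_sum_ge; [exact: measurable_baker|exact: measurable_digit].
Qed.

Let mbackward (M n : nat) : measurable (square `&`
    \bigcup_(w in [set w | w \in words n /\ M%:R <= weight phi w]) strip b w).
Proof.
apply: measurableI; first exact: measurable_square.
apply: fin_bigcup_measurable => [|w _]; last exact: measurable_strip.
by apply: sub_finite_set (finite_seq (words n)) => w [].
Qed.

Let forward_ge (M : nat) : exists n,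
  (threshold%:E <= mu (square `&` [set z | (M%:R <= weight phi (itinerary b n z))%R]))%E.
Proof.
have [n] := measure_birkhoff_sum_ge _ _ _ measurable_square measurable_baker
  (baker_square _ b01) muf _ measurable_digit _ _ _ _ phiK mean_gt0 (lexx _) (ler0n _ M).
by move=> H; exists n; under eq_set do rewrite -birkhoff_sum_itinerary.
Qed.

(* The n-th preimage of the set for the past contains the set for the future. *)
Let backward_ge (M : nat) : exists n, (threshold%:E <= mu (square `&`
    \bigcup_(w in [set w | w \in words n /\ (M%:R <= weight phi w)%R]) strip b w))%E.
Proof.
have [n nM] := forward_ge M; exists n; apply: (le_trans nM).
rewrite -[leRHS](invariant_iter _ _ _ measurable_square measurable_baker
  (baker_square _ b01) muf n); [|exact: mbackward|exact: subIsetl].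
apply: le_measure; rewrite ?inE; [exact: mforward| |].
  apply: measurableI; first exact: measurable_square.
  by apply: measurable_iter_preimage; [exact: measurable_baker|exact: mbackward].
move=> z [sz wz]; split => //; split; first exact: iter_baker_square.
exists (itinerary b n z); first by split=> //; rewrite mem_words size_itinerary.
apply: strip_iter => //.
by have /squareP[/andP[? ?] _] := sz; rewrite ler_norml; apply/andP.
Qed.

Lemma measure_unbounded_forward : mu unbounded_forward = 1%E.
Proof.
apply: (ergodic_forward_invariant _ _ _ measurable_square measurable_baker
  (baker_square _ b01) muf).
- by apply: bigcap_measurable => // M _; exact: bigcup_measurable.
- by move=> z /(_ 0%N Logic.I)[n _ []].
- move=> z zL M _; have [n _ [sz]] := zL (M + k)%N Logic.I; rewrite /= natrD.
  case: n => [|n] /=.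
    rewrite /weight big_nil => Mk; exfalso; have := ler0n R M; have := Kk.
    by move: K0 Mk; lra.
  rewrite /weight big_cons => Mk; exists n => //; split; first exact: baker_square.
  by rewrite /= /weight; have := phileK (digit z); have := Kk; lra.
- apply: lt_le_trans (_ : (threshold%:E <= _)%E); first by rewrite lte_fin.
  apply: measure_bigcap_bigcup_ge => // M n z [sz Mz]; split => //.
  by apply: le_trans Mz; rewrite ler_nat.
Qed.

Lemma measure_unbounded_backward : mu unbounded_backward = 1%E.
Proof.
apply: (ergodic_forward_invariant _ _ _ measurable_square measurable_baker
  (baker_square _ b01) muf).
- by apply: bigcap_measurable => // M _; exact: bigcup_measurable.
- by move=> z /(_ 0%N Logic.I)[n _ []].
- move=> z zL M _; have [n _ [sz [w [wn Mw] wz]]] := zL (M + k)%N Logic.I.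
  exists n.+1 => //; split; first exact: baker_square.
  exists (rcons w (digit z)); last exact: strip_baker.
  split; first by move: wn; rewrite !mem_words size_rcons => /eqP ->.
  have := phiK (digit z); rewrite ler_norml => /andP[? _].
  by move: Mw; rewrite /weight natrD -cats1 big_cat big_seq1/=; have := Kk; lra.
- apply: lt_le_trans (_ : (threshold%:E <= _)%E); first by rewrite lte_fin.
  apply: measure_bigcap_bigcup_ge => // M n z [sz [w [wn Mw] wz]]; split => //.
  by exists w => //; split => //; apply: le_trans Mw; rewrite ler_nat.
Qed.

(* A word of large weight is long, so that unbounded weights occur at infinitely
   many lengths. *)
Let large N : exists M : nat, forall w, M%:R <= weight phi w -> (N <= size w)%N.
Proof.
exists (N * k)%N => w Mw; rewrite leqNgt; apply/negP => wN.
have := weight_le phi K w phileK; rewrite -mulr_natl => wK.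
have : (size w).+1%:R <= N%:R :> R by rewrite ler_nat.
move: Mw; rewrite natrM -natr1; have := Kk; have := ler0n R (size w); move: K0 wK.
nra.
Qed.

(** Cover by the sets of points with a given itinerary of nonnegative weight, which
    are thin in the second coordinate. *)
Lemma measure_dim_le_forward s : 0 <= s ->
  (expR (phi true) + expR (phi false)) / 2^-1 * 2^-1 `^ s < 1 ->
  (measure_dim mu <= s%:E)%E.
Proof.
move=> s0 ths; apply: (@le_trans _ _ (hausdorff_dim unbounded_forward)).
  apply: ereal_inf_lbound; exists unbounded_forward => //; split.
  - by apply: bigcap_measurable => // M _; exact: bigcup_measurable.
  - by move=> z /(_ 0%N Logic.I)[n _ []].
  - exact: measure_unbounded_forward.
apply: (@hausdorff_dim_limsup_strips _ _
  (fun n => [seq w <- words n | 0 <= weight phi w])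
  (fun n w => [set z | square z /\ itinerary b n z = w]) snd fst _ 2^-1
  (expR (phi true) + expR (phi false))) => //.
- by move=> q q'; rewrite addrC; exact: eucl_dist_le_add.
- lra.
- exact: size_words_weight_ge0.
- by move=> n w q q' [sq <-] [sq' /esym e]; exact: itinerary_dist e.
- by move=> q /(_ 0%N Logic.I)[n _ [/squareP[]]].
- move=> z zL N; have [M wM] := large N; have [n _ [sz Mn]] := zL M Logic.I.
  exists n; first by have := wM _ Mn; rewrite size_itinerary.
  exists (itinerary b n z); split => //.
  by rewrite mem_filter mem_words size_itinerary eqxx andbT (le_trans _ Mn).
Qed.

(** Cover by the strips of words of nonnegative weight, for which the mean
    contraction rate is at least kappa; bounding their number by that of all words
    is enough. *)
Lemma measure_dim_le_backward kappa s :
  (forall d, phi d = - ln (b d) - kappa) -> 0 < kappa ->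
  0 <= s -> 2 / expR (- kappa) * expR (- kappa) `^ s < 1 ->
  (measure_dim mu <= s%:E)%E.
Proof.
move=> /funext phiE kappa0 s0 ths.
apply: (@le_trans _ _ (hausdorff_dim unbounded_backward)).
  apply: ereal_inf_lbound; exists unbounded_backward => //; split.
  - by apply: bigcap_measurable => // M _; exact: bigcup_measurable.
  - by move=> z /(_ 0%N Logic.I)[n _ []].
  - exact: measure_unbounded_backward.
apply: (@hausdorff_dim_limsup_strips _ _ words
  (fun n w => [set z | [/\ size w = n, 0 <= weight phi w & strip b w z]])
  fst snd _ (expR (- kappa)) 2) => //.
- exact: eucl_dist_le_add.
- by rewrite expR_gt0 expR_lt1 oppr_lt0.
- by move=> n; rewrite size_words natrX.
- move=> n w q q' [<- w0 wq] [_ _ wq']; apply: (le_trans (strip_width _ _ _ _ wq wq')).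
  by rewrite ler_pM2l//; apply: word_ratio_le => //; rewrite -phiE.
- by move=> q /(_ 0%N Logic.I)[n _ [/squareP[]]].
- move=> z zL N; have [M wM] := large N; have [n _ [_ [w [wn Mw] wz]]] := zL M Logic.I.
  exists n; first by move: wn (wM _ Mw); rewrite mem_words => /eqP ->.
  exists w; split => //; split => //; last exact: le_trans Mw.
  by apply/eqP; rewrite -mem_words.
Qed.

End almost_everywhere.
End baker_measures.

(** * The bound on the dimension *)

Section bias.
Context {R : realType}.

Lemma expR_le_quadratic (x : R) : x <= 2^-1 -> expR x <= 1 + x + 2 * x ^+ 2.
Proof.
move=> x1; have ex := expR_ge1Dx (- x); have := expRxMexpNx_1 x.
have := expR_gt0 x; have := expR_gt0 (- x); nra.
Qed.

(** Up to the factor t, the indicator of the digit e minus (1 + delta) / 2: the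
    mean is positive if e has probability at least 1/2 + delta, whereas it is
    negative for fair digits, which makes the Chernoff bound smaller than 2 ^ n
    for small t. *)
Definition bias (t delta : R) (e d : bool) : R :=
  if d == e then t * ((1 - delta) / 2) else - (t * ((1 + delta) / 2)).

(** To first order in t the sum is 2 - t * delta, and the error is at most
    2 * t ^ 2, which is half of t * delta for this t. *)
Lemma bias_sum_lt2 (t delta : R) e : 0 < delta < 1 -> t = delta / 4 ->
  1 < expR (bias t delta e true) + expR (bias t delta e false) < 2.
Proof.
move=> /andP[d0 d1] tE.
have -> : expR (bias t delta e true) + expR (bias t delta e false) =
    expR (t * ((1 - delta) / 2)) + expR (- (t * ((1 + delta) / 2))).
  by case: e; rewrite /bias//= addrC.
set x := t * _; set y := - _.
have x0 : 0 < x by rewrite mulr_gt0; lra.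
have x1 : x <= 2^-1 by rewrite /x tE; nra.
have t0 : 0 < t by rewrite tE divr_gt0.
have y1 : y <= 2^-1.
  by apply: (@le_trans _ _ 0); [rewrite oppr_le0 mulr_ge0//; lra|lra].
have ex : 1 < expR x by rewrite expR_gt1.
have := expR_le_quadratic _ x1; have := expR_le_quadratic _ y1.
have := expR_gt0 y; have : x + y = - t * delta by rewrite /x /y; field.
have : x ^+ 2 + y ^+ 2 <= t ^+ 2.
  rewrite -subr_ge0 (_ : _ - _ = t ^+ 2 * ((1 - delta) * (1 + delta)) / 2).
    by rewrite divr_ge0// mulr_ge0 ?sqr_ge0// mulr_ge0; lra.
  by rewrite /x /y; field.
rewrite tE => ? ? ? ? ?; apply/andP; split; first by lra.
by have : 0 < delta * delta; [rewrite mulr_gt0|lra].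
Qed.

End bias.

Theorem theorem2p3 (R : realType) (b1 b2 : R) :
  0 < b1 < 1 -> 0 < b2 < 1 -> 1 <= b1 + b2 -> b1 * b2 < 1 / 4 ->
  (ereal_sup [set measure_dim mu |
     mu in [set mu : probability (plane R) R |
       ergodic_on square (baker b1 b2) mu]] < 2%:E)%E.
Proof.
move=> b1_01 b2_01 _ b12; have /andP[b1_0 b1_1] := b1_01; have /andP[b2_0 b2_1] := b2_01.
pose b d := if d then b1 else b2.
have b01 d : 0 < b d < 1 by case: d.
have a1 : 0 < - ln b1 by rewrite oppr_gt0 ln_lt0.
have a2 : 0 < - ln b2 by rewrite oppr_gt0 ln_lt0.
have a12 : 2 * ln 2 < - ln b1 - ln b2.
  rewrite -opprD -lnM ?posrE// mulr_natl -lnXn// -lnV ?posrE ?mulr_gt0//.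
  rewrite ltr_ln ?posrE ?invr_gt0 ?mulr_gt0// -[ltLHS]invrK ltf_pV2 ?posrE ?invr_gt0 ?mulr_gt0//.
  by lra.
have l2 : 0 < ln 2 :> R by rewrite ln_gt0 ?ltr1n.
(* kappa is the midpoint of ln 2 and (- ln b1 - ln b2) / 2, the mean of - ln (b d)
   for p = 1/2; delta is small enough for that mean to exceed kappa whenever p is
   within delta of 1/2. *)
pose kappa := (2 * ln 2 - ln b1 - ln b2) / 4.
pose delta := (- ln b1 - ln b2 - 2 * ln 2) / (8 * (- ln b1 - ln b2)).
have s0 : 0 < - ln b1 - ln b2 by lra.
have deltaE : delta * (- ln b1 - ln b2) = (- ln b1 - ln b2 - 2 * ln 2) / 8.
  by rewrite /delta; field; rewrite gt_eqF.
have delta01 : 0 < delta < 1.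
  apply/andP; split; first by rewrite divr_gt0//; lra.
  by rewrite ltr_pdivrMr; lra.
have kappa0 : 0 < kappa by rewrite /kappa; lra.
have r01 : 0 < expR (- kappa) < 1 by rewrite expR_gt0 expR_lt1 oppr_lt0.
have r2 : 2 * expR (- kappa) < 1.
  rewrite -[X in X * _]lnK ?posrE// -expRD expR_lt1 /kappa; lra.
have [sx [sx0 sx2 sxP]] := exists_dim_lt2 _ 2 r01 ltac:(by []) r2.
have half01 : 0 < (2^-1 : R) < 1 by lra.
pose phi := bias (delta / 4) delta.
pose theta e := expR (phi e true) + expR (phi e false).
have sy e : exists s, [/\ 0 <= s, s < 2 & theta e / 2^-1 * 2^-1 `^ s < 1].
  have /andP[th1 th2] : 1 < theta e < 2 by exact: bias_sum_lt2.
  by apply: exists_dim_lt2 => //; lra.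
have [s1 [s10 s12 s1P]] := sy true; have [s3 [s20 s22 s2P]] := sy false.
apply: (@le_lt_trans _ _ (Num.max sx (Num.max s1 s3))%:E); last first.
  by rewrite lte_fin !gt_max sx2 s12 s22.
apply: ge_ereal_sup => _ [mu muf <-].
set p : R := fine (mu (square `&` [set z | digit z])).
have [p1|p1] := leP (2^-1 + delta) p.
  apply: (@le_trans _ _ s1%:E); last by rewrite lee_fin !le_max lexx orbT.
  apply: (@measure_dim_le_forward _ b b01 mu muf (phi true)) => //.
  rewrite -/p /phi /bias/=; have /andP[d0 d1] := delta01.
  rewrite [ltRHS](_ : _ = delta / 4 * (p - (1 + delta) / 2)); last by field.
  by rewrite mulr_gt0//; lra.
have [p2|p2] := leP p (2^-1 - delta).
  apply: (@le_trans _ _ s3%:E); last by rewrite lee_fin !le_max lexx !orbT.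
  apply: (@measure_dim_le_forward _ b b01 mu muf (phi false)) => //.
  rewrite -/p /phi /bias/=; have /andP[d0 d1] := delta01.
  rewrite [ltRHS](_ : _ = delta / 4 * (1 - p - (1 + delta) / 2)); last by field.
  by rewrite mulr_gt0//; lra.
apply: (@le_trans _ _ sx%:E); last by rewrite lee_fin !le_max lexx.
apply: (@measure_dim_le_backward _ b b01 mu muf (fun d => - ln (b d) - kappa) _ kappa) => //.
rewrite -/p /b /kappa; move: deltaE p1 p2 s0 a1 a2 a12.
set x := - ln b1; set y := - ln b2; nra.
Qed.
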